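(* Let $f\colon\mathbb{R}^J\to\,]-\infty,+\infty]$ be a convex function of Legendre type with $U:=\operatorname{int}\operatorname{dom}f$, and let $C$ be a nonempty bounded closed subset of $U$. Then $$\overrightarrow{Q}^{f}_{C}=\nabla f^*\circ\overleftarrow{Q}^{f^*}_{\nabla f(C)}\circ\nabla f\quad\text{(on }U)\qquad\text{and}\qquad \overleftarrow{Q}^{f^*}_{\nabla f(C)}=\nabla f\circ\overrightarrow{Q}^{f}_{C}\circ\nabla f^*\quad\text{(on }\operatorname{int}\operatorname{dom}f^* ).$$
   Context: $\mathbb{R}^J$ is the standard Euclidean space. A convex function of Legendre type is a proper, lower semicontinuous, convex function $f$ that is essentially smooth (with $\operatorname{int}\operatorname{dom} f\neq\varnothing$, $f$ is differentiable on $\operatorname{int}\operatorname{dom} f$ and $\|\nabla f(x_n)\|\to+\infty$ whenever $(x_n)$ is a sequence in $\operatorname{int}\operatorname{dom} f$ converging to a boundary point of it) and essentially strictly convex ($f$ is strictly convex on every convex subset of $\operatorname{dom}\partial f$). No coercivity of $f$ is assumed here. $f^*$ is the Fenchel conjugate; it is again of Legendre type, and $\nabla f\colon\operatorname{int}\operatorname{dom}f\to\operatorname{int}\operatorname{dom}f^*$ is a homeomorphism with inverse $\nabla f^*$. For a Legendre function $h$, the Bregman distance is $D_h(x,y)=h(x)-h(y)-\langle\nabla h(y),x-y\rangle$ if $y\in\operatorname{int}\operatorname{dom}h$, and $+\infty$ otherwise. For a nonempty compact set $S\subset\operatorname{int}\operatorname{dom}h$ and $y\in\operatorname{int}\operatorname{dom}h$,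 the left and right Bregman farthest-point maps are the set-valued maps $\overleftarrow{Q}^{h}_S(y)=\operatorname{argmax}_{x\in S}D_h(x,y)$ and $\overrightarrow{Q}^{h}_S(y)=\operatorname{argmax}_{x\in S}D_h(y,x)$ (sets of maximizers). Single-valued maps are applied to sets elementwise. *)

(* Defs.v *)
From HB Require Import structures.
From mathcomp Require Import all_boot all_order all_algebra.
From mathcomp Require Import all_classical all_reals all_analysis.
Import Order.TTheory GRing.Theory Num.Theory.
Import numFieldNormedType.Exports.

Set Implicit Arguments.
Unset Strict Implicit.
Unset Printing Implicit Defensive.

Local Open Scope classical_set_scope.
Local Open Scope ring_scope.

Section Euclidean.
Context {R : realType} {J : nat}.
Implicit Types u v : 'rV[R]_J.

Definition dotv u v : R := \sum_(i < J) u 0 i * v 0 i.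

(* The library norm on ['rV[R]_J] is the sup norm; it has the same topology and
   the same bounded sets as the Euclidean norm. *)
Definition enorm u : R := Num.sqrt (dotv u u).

End Euclidean.

Section ConvexFunctions.
Context {R : realType} {J : nat}.
Implicit Types (f h : 'rV[R]_J -> \bar R) (x y u : 'rV[R]_J).

Definition dom f : set 'rV[R]_J := [set x | (f x < +oo)%E].

Definition intdom f : set 'rV[R]_J := (dom f)°.

Definition proper f : Prop :=
  dom f !=set0 /\ forall x, (-oo < f x)%E.

(* In [\bar R] one has [-oo + +oo = -oo], so this inequality expresses convexity
   only for functions that do not take the value [-oo]. *)
Definition econvex f : Prop :=
  forall x y (t : R), 0 < t -> t < 1 ->
    (f (t *: x + (1 - t) *: y)%R <= t%:E * f x + (1 - t)%R%:E * f y)%E.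

Definition strictly_convex_on (A : set 'rV[R]_J) f : Prop :=
  forall x y (t : R), A x -> A y -> x <> y -> 0 < t -> t < 1 ->
    (f (t *: x + (1 - t) *: y)%R < t%:E * f x + (1 - t)%R%:E * f y)%E.

(* For a proper [f], [subdiff f x] is empty when [f x = +oo]. *)
Definition subdiff f x : set 'rV[R]_J :=
  [set u | forall z, (f x + (dotv u (z - x)%R)%:E <= f z)%E].

Definition dom_subdiff f : set 'rV[R]_J := [set x | subdiff f x !=set0].

(* [f] is finite on [intdom f] when it is proper, so there [f] agrees near each
   point with the real-valued function [finepart f]. *)
Definition finepart f : 'rV[R]_J -> R^o := fun x => fine (f x).

Definition grad f x : 'rV[R]_J :=
  \row_(i < J) 'd (finepart f) x (delta_mx 0 i).

(* [intdom f] is open, so its boundary is [closure (intdom f) `\` intdom f]. *)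
Definition essentially_smooth f : Prop :=
  [/\ intdom f !=set0,
      forall x, intdom f x -> differentiable (finepart f) x &
      forall (x_ : nat -> 'rV[R]_J) (a : 'rV[R]_J),
        (forall n, intdom f (x_ n)) ->
        (closure (intdom f) `\` intdom f) a ->
        x_ @ \oo --> a ->
        (fun n => enorm (grad f (x_ n))) @ \oo --> +oo].

Definition essentially_strictly_convex f : Prop :=
  forall A : set 'rV[R]_J, convex_set A -> A `<=` dom_subdiff f ->
    strictly_convex_on A f.

Definition legendre f : Prop :=
  [/\ proper f, lower_semicontinuous f, econvex f,
      essentially_smooth f & essentially_strictly_convex f].

Definition fenchel f u : \bar R :=
  ereal_sup [set ((dotv x u)%:E - f x)%E | x in [set: 'rV[R]_J]].

Definition bregman h x y : \bar R :=
  if `[< intdom h y >] then (h x - h y - (dotv (grad h y) (x - y)%R)%:E)%E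
  else +oo%E.

Definition argmax (S : set 'rV[R]_J) (F : 'rV[R]_J -> \bar R) :
    set 'rV[R]_J :=
  [set x | S x /\ forall z, S z -> (F z <= F x)%E].

Definition lfarthest h (S : set 'rV[R]_J) y : set 'rV[R]_J :=
  argmax S (fun x => bregman h x y).

Definition rfarthest h (S : set 'rV[R]_J) y : set 'rV[R]_J :=
  argmax S (fun x => bregman h y x).

End ConvexFunctions.

(* Main.v *)
(* With U = int dom f and V = int dom f*, the gradients of f and f* are mutually
   inverse bijections between U and V; then D_f(y, x) equals
   D_{f*}(grad f x, grad f y) on U, and both identities follow by transporting
   the maximizers.

   If u = grad f x with x in U, essential strict convexity makes x the only
   minimizer of f - <u, .>, which therefore grows linearly away from x with a
   positive rate outside every ball around x.  Taking suprema, this says that f*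
   is finite near u and that f*(u + w) - f*(u) - <x, w> = o(w), so u is in V and
   grad f* u = x.  Conversely, if u is in V then f - <u, .> is coercive, hence
   has a minimizer x, that is, u is a subgradient of f at x.  Essential
   smoothness forces x into U, whence u = grad f x. *)
Require Import Defs.
From HB Require Import structures.
From mathcomp Require Import all_boot all_order all_algebra.
From mathcomp Require Import all_classical all_reals all_analysis.
From mathcomp Require Import ring lra.
Import Order.TTheory GRing.Theory Num.Theory.
Import numFieldNormedType.Exports.

Local Open Scope classical_set_scope.
Local Open Scope ring_scope.

(** * The inner product and its bounds in the sup norm *)

Section Dotv.
Context {R : realType} {J : nat}.
Implicit Types u v w : 'rV[R]_J.

Lemma dotvC u v : dotv u v = dotv v u.
Proof. by apply: eq_bigr => i _; rewrite mulrC. Qed.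

Lemma dotvDr u v w : dotv u (v + w) = dotv u v + dotv u w.
Proof. by rewrite -big_split; apply: eq_bigr => i _; rewrite mxE mulrDr. Qed.

Lemma dotvZr u (a : R) v : dotv u (a *: v) = a * dotv u v.
Proof. by rewrite mulr_sumr; apply: eq_bigr => i _; rewrite mxE mulrCA. Qed.

Lemma dotvNr u v : dotv u (- v) = - dotv u v.
Proof. by rewrite -scaleN1r dotvZr mulN1r. Qed.

Lemma dotvBr u v w : dotv u (v - w) = dotv u v - dotv u w.
Proof. by rewrite dotvDr dotvNr. Qed.

Lemma dotvBl u v w : dotv (u - v) w = dotv u w - dotv v w.
Proof. by rewrite !(dotvC _ w) dotvBr. Qed.

Lemma dotv_delta u i : dotv u (delta_mx 0 i) = u 0 i.
Proof.
rewrite /dotv (bigD1 i) //= big1 ?addr0; first by rewrite mxE !eqxx mulr1.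
by move=> j ji; rewrite mxE (negbTE ji) andbF mulr0.
Qed.

Lemma ler_coord_norm u i : `|u 0 i| <= `|u|.
Proof.
rewrite [leRHS]/Num.norm/= mx_normrE.
exact: (le_bigmax _ (fun ij : 'I_1 * 'I_J => `|u ij.1 ij.2|) (0, i)).
Qed.

Lemma ler_norm_coord u (b : R) :
  0 <= b -> (forall i, `|u 0 i| <= b) -> `|u| <= b.
Proof.
move=> b0 ub; rewrite [leLHS]/Num.norm/= mx_normrE; apply: bigmax_le => //= -[j i] _.
by rewrite ord1; exact: ub.
Qed.

(** The norm is the sup norm, so each of the [J] summands is bounded separately; hence the factor
    [J]. *)
Lemma ler_norm_dotv u v : `|dotv u v| <= J%:R * (`|u| * `|v|).
Proof.
apply: le_trans (ler_norm_sum _ _ _) _.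
rewrite [leRHS](_ : _ = \sum_(i < J) (`|u| * `|v|)); last first.
  by rewrite sumr_const card_ord mulr_natl.
by apply: ler_sum => i _; rewrite normrM ler_pM ?ler_coord_norm.
Qed.

Lemma dotv_is_linear u : linear (dotv u : 'rV[R]_J -> R^o).
Proof. by move=> a v w; rewrite dotvDr dotvZr. Qed.

HB.instance Definition _ u :=
  GRing.isLinear.Build R 'rV[R]_J R^o *:%R (dotv u) (dotv_is_linear u).

Lemma dotv_continuous u : continuous (dotv u : 'rV[R]_J -> R^o).
Proof.
apply: (@continuous_big R _ +%R) => [|i _ v]; first exact: add_continuous.
apply: (@continuousM _ 'rV[R]_J (fun=> u 0 i)); first exact: cst_continuous.
exact: coord_continuous.
Qed.

Lemma enorm_le u (b : R) :
  0 <= b -> (forall i, `|u 0 i| <= b) -> enorm u <= Num.sqrt (J%:R * b ^+ 2).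
Proof.
move=> b0 ub; apply: ler_wsqrtr.
rewrite [leRHS](_ : _ = \sum_(i < J) (b ^+ 2)); last first.
  by rewrite sumr_const card_ord mulr_natl.
by apply: ler_sum => i _; rewrite -expr2 -real_normK ?num_real// lerXn2r ?nnegrE.
Qed.

Lemma delta_norm_le (a : R) (i : 'I_J) : `|a *: delta_mx 0 i : 'rV[R]_J| <= `|a|.
Proof.
apply: ler_norm_coord => // j; rewrite !mxE eqxx normrM.
by rewrite ler_piMr//; case: (j == i); rewrite ?normr1 ?normr0.
Qed.

End Dotv.

(** * Attainment of minima on compact sets *)

Section LowerSemicontinuous.
Context {R : realType}.

(** Lower semicontinuity is tested at real levels, so extended values are compared through a real
    one. *)
Lemma ereal_lt_split (x y : \bar R) :
  (x < y)%E -> exists2 a : R, (x <= a%:E)%E & (a%:E < y)%E.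
Proof.
case: x => [r xy| |]; first by exists r.
  by rewrite ltNge leey.
case: y => [s _| _|//]; last by exists 0; rewrite ?leNye ?ltry.
by exists (s - 1); rewrite ?leNye// lte_fin; lra.
Qed.

Lemma lsc_attains_min {X : topologicalType} (g : X -> \bar R) (K : set X) :
  compact K -> K !=set0 -> lower_semicontinuous g ->
  exists2 x, K x & forall z, K z -> (g x <= g z)%E.
Proof.
move=> Kc [x0 Kx0] glsc; apply: contrapT => nomin.
have lower x : K x -> exists2 z, K z & (g z < g x)%E.
  move=> Kx; apply: contrapT => nlower; apply: nomin; exists x => // z Kz.
  by rewrite leNgt; apply/negP => zx; apply: nlower; exists z.
(* The nonempty sublevel sets of [g] on [K] form a filter base, along which
   every point of [K] would eventually lie above the current level. *)
pose F := filter_from K (fun i => [set z | K z /\ (g z <= g i)%E]).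
have FF : Filter F.
  apply: filter_from_filter; first by exists x0.
  move=> i j Ki Kj; case: (leP (g i) (g j)) => ij.
    by exists i => // z [Kz zi]; split; split => //; exact: le_trans ij.
  by exists j => // z [Kz zj]; split; split => //; exact: le_trans (ltW ij).
have Fcov : forall x, K x -> \near x & F, (fun i z => K i /\ (g i < g z)%E) F x.
  move=> x Kx; have [z Kz zx] := lower x Kx.
  have [a za ax] := ereal_lt_split _ _ zx.
  have [V Vx Va] := glsc x a ax.
  exists (V, [set i | K i /\ (g i <= g z)%E]) => /=; first by split => //; exists z.
  case=> y i /= [Vy [Ki iz]]; split => //.
  by apply: le_lt_trans (Va _ Vy); exact: le_trans za.
have [i Ki iP] := (compact_near_coveringP K).1 Kc _ F
  (fun i z => K i /\ (g i < g z)%E) FF Fcov.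
have [|_] := iP i _ i Ki; first by split.
by rewrite ltxx.
Qed.

End LowerSemicontinuous.

(** * Linear perturbations and subgradients *)

Section Tilt.
Context {R : realType} {J : nat}.
Implicit Types (f g : 'rV[R]_J -> \bar R) (u x z : 'rV[R]_J).

(** For proper [f], the minimizers are the points with subgradient [u], and minus the infimum is
    [fenchel f u]. *)
Definition tilt f u z : \bar R := (f z - (dotv u z)%:E)%E.

Lemma proper_tilt f u : Defs.proper f -> Defs.proper (tilt f u).
Proof.
move=> [[x fx] fNy]; split.
  exists x; move: fx; rewrite /dom/= /tilt.
  by case: (f x) => [r _||]; rewrite ?ltxx// -EFinB ltry.
by move=> z; rewrite /tilt; have := fNy z; case: (f z) => //= r _; rewrite -EFinB ltNyr.
Qed.

Lemma econvex_tilt f u : Defs.proper f -> econvex f -> econvex (tilt f u).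
Proof.
move=> [_ fNy] fcvx x y t t0 t1; have := fcvx x y t t0 t1.
have t10 : 0 < 1 - t by lra.
rewrite /tilt dotvDr !dotvZr; move: (fNy x) (fNy y) (fNy (t *: x + (1 - t) *: y)).
have infty (s : R) : 0 < s -> (s%:E * +oo = +oo :> \bar R)%E.
  by move=> s0; rewrite gt0_muley.
case: (f x) => [a| |//] _; case: (f y) => [b| |//] _ _ //=; rewrite ?infty//=.
- case: (f _) => [c| |] //=; rewrite -?EFinM -?EFinD -?EFinB ?lee_fin ?leNye//.
  by lra.
- by move=> _; rewrite -?EFinD -?EFinM addey ?leey.
- by move=> _; rewrite -?EFinD -?EFinM addye ?leey.
- by move=> _; rewrite addye ?leey.
Qed.

Lemma lsc_tilt f u : lower_semicontinuous f -> lower_semicontinuous (tilt f u).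
Proof.
move=> flsc x a ax.
(* The gap between [a + dotv u x] and [b] absorbs the variation of [dotv u] near [x]. *)
have [b ab bx] : exists2 b, a + dotv u x < b & (b%:E < f x)%E.
  move: ax; rewrite /tilt; case: (f x) => [r| _|//].
    rewrite -EFinB lte_fin => ar.
    by exists ((a + dotv u x + r) / 2); rewrite ?lte_fin; lra.
  by exists (a + dotv u x + 1); rewrite ?ltry//; lra.
have [V Vx Vb] := flsc x b bx.
have near_lt : \forall y \near x, dotv u y < b - a.
  by apply: (cvgr_lt _ (dotv_continuous u x)); lra.
exists (V `&` [set y | dotv u y < b - a]); first exact: filterI.
move=> y [/Vb by_ /= uy]; move: by_; rewrite /tilt.
by case: (f y) => //= [r|_]; rewrite -?EFinB ?lte_fin ?ltry//; lra.
Qed.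

Lemma subdiffP f x u : Defs.proper f ->
  subdiff f x u <-> forall z, (tilt f u x <= tilt f u z)%E.
Proof.
move=> [_ fNy]; split=> h z; have := h z; rewrite /tilt dotvBr;
  case: (f x) (fNy x) (f z) (fNy z) => [a| |//] _ [b| |//] _ //=.
all: by rewrite -?EFinB -?EFinD ?lee_fin ?leey//; lra.
Qed.

Lemma subdiff_fin f x u : Defs.proper f -> subdiff f x u -> exists a, f x = a%:E.
Proof.
move=> [[z fz] fNy] /(_ z); move: fz; rewrite /dom/=.
by case: (f x) (fNy x) => [a| |//] _; [exists a|case: (f z)].
Qed.

End Tilt.

(** * Linear growth away from a strict minimizer *)

Section Convexity.
Context {R : realType} {J : nat}.
Implicit Types (f g : 'rV[R]_J -> \bar R) (u x y z : 'rV[R]_J).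

Lemma econvex_fin f x y (a b t : R) : econvex f ->
  f x = a%:E -> f y = b%:E -> 0 < t -> t <= 1 ->
  (f (y + t *: (x - y))%R <= (b + t * (a - b))%:E)%E.
Proof.
move=> fcvx fx fy t0; rewrite le_eqVlt => /predU1P[->|t1].
  by rewrite scale1r addrC subrK mul1r addrC subrK fx.
have := fcvx x y t t0 t1; rewrite fx fy -!EFinM -EFinD => /le_trans.
rewrite (_ : t *: x + _ = y + t *: (x - y)); last first.
  by rewrite scalerBr scalerBl scale1r addrCA.
by apply; rewrite lee_fin; lra.
Qed.

Lemma compact_sphere x (e : R) : compact [set z | `|z - x| = e].
Proof.
apply: bounded_closed_compact.
  exists (`|x| + e); split => [|M xeM z /= zx]; first exact: num_real.
  apply: ltW; apply: le_lt_trans xeM.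
  by rewrite -[X in `|X| <= _](subrK x) (le_trans (ler_normD _ _))// zx addrC.
apply: (@preimage_closed _ _ (fun z => `|z - x|) [set r | r = e]); last exact: closed_eq.
move=> z _; exact: (cvg_norm (cvgB cvg_id (cvg_cst x))).
Qed.

(** On the sphere of radius [e], [g] exceeds [g x] by some [d > 0], by compactness. Convexity on the
    segment from [x] to [z], which crosses the sphere, gives slope at least [d / e]. *)
Lemma strict_min_growth g x : Defs.proper g -> lower_semicontinuous g ->
  econvex g -> (forall z, z <> x -> (g x < g z)%E) ->
  forall e : R, 0 < e -> exists2 c : R, 0 < c &
    forall z, e <= `|z - x| -> (g x + (c * `|z - x|)%:E <= g z)%E.
Proof.
move=> [[y gy] gNy] glsc gcvx xmin e e0.
have [a gx] : exists a, g x = a%:E.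
  have : (g x < +oo)%E.
    have [<-//|/eqP /xmin yx] := eqVneq y x.
    exact: lt_trans gy.
  by case: (g x) (gNy x) => [a| |//] _ //; exists a.
have [d d0 dP] : exists2 d : R, 0 < d &
    forall z, `|z - x| = e -> ((a + d)%:E <= g z)%E.
  (* If the sphere is empty (as when [J = 0]) or the minimum on it is [+oo], any positive [d]
     serves. *)
  have [K0|/set0P Kn0] := eqVneq [set z | `|z - x| = e] set0.
    exists 1 => // z zx; have : [set z | `|z - x| = e] z by [].
    by rewrite K0.
  have [z zx zmin] := lsc_attains_min _ _ (compact_sphere x e) Kn0 glsc.
  have /xmin : z <> x.
    by move=> zE; move: zx; rewrite zE /= subrr normr0 => e0'; rewrite -e0' ltxx in e0.
  rewrite gx; case E : (g z) => [r| |//].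
    rewrite lte_fin => ar; exists (r - a) => [|w /zmin]; first lra.
    by rewrite E addrCA subrr addr0.
  by move=> _; exists 1 => // w /zmin; rewrite E leye_eq => /eqP ->; rewrite leey.
exists (d / e) => [|z ez]; first exact: divr_gt0.
rewrite gx; case gz : (g z) (gNy z) => [b| |//] _; last by rewrite leey.
have n0 : 0 < `|z - x| by exact: lt_le_trans ez.
have s0 : 0 < e / `|z - x| by exact: divr_gt0.
have s1 : e / `|z - x| <= 1 by rewrite ler_pdivrMr// mul1r.
have := econvex_fin _ _ _ _ _ _ gcvx gz gx s0 s1.
move/(le_trans (dP _ _)); rewrite [x + _]addrC addrK normrZ gtr0_norm//.
rewrite divfK ?gt_eqF// => /(_ erefl).
rewrite !lee_fin lerD2l mulrAC ler_pdivlMr// => ds.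
by rewrite -lerBrDl mulrAC ler_pdivrMr// [leRHS]mulrC.
Qed.

End Convexity.

(** * Gradients and subgradients on the interior of the domain *)

Section Gradient.
Context {R : realType} {J : nat}.
Implicit Types (f : 'rV[R]_J -> \bar R) (u v x y z : 'rV[R]_J).

Lemma diff_grad f x v : 'd (finepart f) x v = dotv (grad f x) v.
Proof.
rewrite [in LHS](row_sum_delta v) linear_sum; apply: eq_bigr => i _.
by rewrite linearZ /= mxE mulrC.
Qed.

Lemma right_derivative f x v : differentiable (finepart f) x ->
  h^-1 * (finepart f (x + h *: v) - finepart f x) @[h --> 0^'+] -->
    dotv (grad f x) v.
Proof.
move=> fx; apply: cvg_dnbhs_at_right; rewrite -diff_grad -deriveE//.
rewrite (_ : (fun h => _) =
    fun h => h^-1 *: ((finepart f \o shift x) (h *: v) - finepart f x)).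
  exact: diff_derivable.
by apply/funext => h /=; rewrite [x + _]addrC.
Qed.

Lemma intdomP f x : intdom f x ->
  exists2 r : R, 0 < r & forall v, `|v| < r -> (f (x + v)%R < +oo)%E.
Proof.
move=> /nbhs_ballP[r /= r0 rP]; exists r => // v vr; apply: rP.
by rewrite -ball_normE /ball_/= opprD addNKr normrN.
Qed.

Lemma intdom_ball f x (r : R) : 0 < r ->
  (forall v, `|v| < r -> (f (x + v)%R < +oo)%E) -> intdom f x.
Proof.
move=> r0 rP; apply/nbhs_ballP; exists r => //= y.
rewrite -ball_normE /ball_/= distrC => /rP.
by rewrite [x + _]addrC subrK.
Qed.

Lemma intdom_dom f x : intdom f x -> (f x < +oo)%E.
Proof. exact: interior_subset. Qed.

Lemma finepartK f x : Defs.proper f -> (f x < +oo)%E -> f x = (finepart f x)%:E.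
Proof. by move=> [_ /(_ x)]; rewrite /finepart; case: (f x). Qed.

Lemma near_intdom f x v : intdom f x ->
  \forall h \near (0 : R)^'+, (f (x + h *: v)%R < +oo)%E.
Proof.
move=> /intdomP[r r0 rP]; near=> h; apply: rP.
rewrite normrZ gtr0_norm; last by near: h; exact: nbhs_right_gt.
(* Adding 1 keeps the divisor positive when [v = 0]. *)
have v1 : 0 < `|v| + 1 by rewrite ltr_wpDl.
have /le_lt_trans : h * `|v| <= h * (`|v| + 1) by rewrite ler_wpM2l ?lerDl//.
apply; rewrite -ltr_pdivlMr//; near: h; apply: nbhs_right_lt; exact: divr_gt0.
Unshelve. all: by end_near. Qed.

(** By convexity the difference quotient towards [z] is at most [f z - f x] for steps in ]0, 1]; the
    limit keeps this bound. *)
Lemma grad_subdiff f x : Defs.proper f -> econvex f -> intdom f x ->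
  differentiable (finepart f) x -> subdiff f x (grad f x).
Proof.
move=> fp fcvx xU dfx z; have fx := finepartK _ _ fp (intdom_dom _ _ xU).
case fz : (f z) (fp.2 z) => [b| |//] _; last by rewrite leey.
rewrite {1}fx -EFinD lee_fin -lerBrDl.
apply: cvgr_to_le (right_derivative _ _ (z - x) dfx) _.
near=> h.
have h0 : 0 < h by near: h; exact: nbhs_right_gt.
have h1 : h <= 1 by near: h; apply: nbhs_right_le.
have fh : (f (x + h *: (z - x))%R < +oo)%E by near: h; exact: near_intdom.
have := econvex_fin _ _ _ _ _ _ fcvx fz fx h0 h1.
rewrite (finepartK _ _ fp fh) lee_fin [h^-1 * _]mulrC ler_pdivrMr//; lra.
Unshelve. all: by end_near. Qed.

(** A subgradient is bounded by the right derivative in every direction; opposite directions force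
    equality. *)
Lemma subdiff_grad f x u : Defs.proper f -> intdom f x ->
  differentiable (finepart f) x -> subdiff f x u -> u = grad f x.
Proof.
move=> fp xU dfx xu.
have uv v : dotv u v <= dotv (grad f x) v.
  apply: cvgr_to_ge (right_derivative _ _ v dfx) _.
  near=> h.
  have h0 : 0 < h by near: h; exact: nbhs_right_gt.
  have fh : (f (x + h *: v)%R < +oo)%E by near: h; exact: near_intdom.
  have := xu (x + h *: v); rewrite [x + _]addrC addrK addrC (finepartK _ _ fp fh).
  rewrite (finepartK _ _ fp (intdom_dom _ _ xU)) dotvZr -EFinD lee_fin.
  by rewrite [h^-1 * _]mulrC ler_pdivlMr//; lra.
apply/rowP => i; rewrite -!dotv_delta; apply/eqP; rewrite eq_le uv/=.
by have := uv (- delta_mx 0 i); rewrite !dotvNr lerN2.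
Unshelve. all: by end_near. Qed.

(** Contracting a ball around [y] towards [x] with ratio [t] gives a ball of radius [t * r] on which
    [f] is finite. *)
Lemma intdom_segment f x y (t : R) : Defs.proper f -> econvex f ->
  (f x < +oo)%E -> intdom f y -> 0 < t -> t <= 1 -> intdom f (x + t *: (y - x)).
Proof.
move=> fp fcvx fx /intdomP[r r0 rP] t0 t1.
apply: (@intdom_ball _ _ (t * r)); first exact: mulr_gt0.
move=> v vr; have := rP (t^-1 *: v).
rewrite normrZ gtr0_norm ?invr_gt0// mulrC ltr_pdivrMr// mulrC => /(_ vr) fyv.
have := econvex_fin _ _ _ _ _ _ fcvx (finepartK _ _ fp fyv) (finepartK _ _ fp fx) t0 t1.
rewrite addrAC scalerDr scalerA divff ?gt_eqF// scale1r addrA => /le_lt_trans; apply.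
exact: ltry.
Qed.

End Gradient.

(** * Essential smoothness, the conjugate, and inversion of gradients *)

Section Legendre.
Context {R : realType} {J : nat}.
Implicit Types (f h : 'rV[R]_J -> \bar R) (u v x y z w : 'rV[R]_J).

(** A cross-polytope has finitely many vertices, so a finite maximum bounds [h] on them. *)
Lemma intdom_coord_bound h x : intdom h x -> exists r M : R, 0 < r /\
  forall i, (h (x + r *: delta_mx 0 i)%R <= M%:E)%E /\
            (h (x - r *: delta_mx 0 i)%R <= M%:E)%E.
Proof.
move=> /intdomP[r r0 rP].
have small i : `|(r / 2) *: delta_mx 0 i : 'rV[R]_J| < r.
  by apply: le_lt_trans (delta_norm_le _ _) _; rewrite gtr0_norm; lra.
pose F s i : R := fine (h (x + s *: ((r / 2) *: delta_mx 0 i))).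
pose M s := \big[Num.max/0]_i F s i.
(* A value [-oo] becomes 0 under [fine], which is still an upper bound. *)
have hM s i : `|s| = 1 -> (h (x + s *: ((r / 2) *: delta_mx 0 i))%R <= (M s)%:E)%E.
  move=> s1; apply: (@le_trans _ _ (F s i)%:E); last by rewrite lee_fin; exact: le_bigmax.
  have := rP (s *: ((r / 2) *: delta_mx 0 i)).
  rewrite normrZ s1 mul1r => /(_ (small i)).
  by rewrite /F; case: (h _) => //= _; rewrite leNye.
exists (r / 2), (Num.max (M 1) (M (-1))); split=> [|i]; first lra.
have := hM 1 i; have := hM (-1) i; rewrite normrN normr1 scale1r scaleN1r => h1 h2.
split; [apply: le_trans (h2 erefl) _|apply: le_trans (h1 erefl) _];
  by rewrite lee_fin le_max lexx ?orbT.
Qed.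

(* Along the segment from a boundary point [x] to an interior point [y],
   monotonicity bounds the derivative in direction [y - x] from below by its
   value at a subgradient, and then the subgradient inequality at the points
   around [y] bounds the whole gradient. *)
Lemma grad_bounded_near_subdiff f x y u : Defs.proper f -> econvex f ->
  essentially_smooth f -> subdiff f x u -> intdom f y ->
  exists b : R, forall t, 0 < t -> t <= 1 ->
    enorm (grad f (x + t *: (y - x))) <= b.
Proof.
move=> fp fcvx [_ fdiff _] xu yU.
have [r [M [r0 rM]]] := intdom_coord_bound _ _ yU.
have [a fx] := subdiff_fin _ _ _ fp xu.
pose B := `|M - a - dotv u (y - x)| / r.
exists (Num.sqrt (J%:R * B ^+ 2)) => t t0 t1.
set xt := x + t *: (y - x); set g := grad f xt.
have xtU : intdom f xt by apply: intdom_segment => //; rewrite fx ltry.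
have gP : subdiff f xt g by apply: grad_subdiff => //; exact: fdiff.
have [c fxt] := subdiff_fin _ _ _ fp gP.
have uxt := xu xt; have gx := gP x.
rewrite fx fxt -EFinD lee_fin /xt [x + _]addrC addrK dotvZr in uxt.
rewrite fx fxt -EFinD lee_fin /xt opprD addNKr dotvNr dotvZr in gx.
(* Monotonicity: the subgradient inequalities at [x] and [xt] are added and [t] is cancelled. *)
have ug : dotv u (y - x) <= dotv g (y - x) by rewrite -(ler_pM2l t0); lra.
(* The bounds [a + t * dotv u (y - x) <= c] and [ug], the latter weighted by [1 - t], add up to a
   bound free of [t]. *)
have gp p : (f (y + p)%R <= M%:E)%E -> dotv g p <= `|M - a - dotv u (y - x)|.
  move=> /(le_trans (gP _)); rewrite fxt -EFinD lee_fin.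
  rewrite (_ : y + p - xt = (1 - t) *: (y - x) + p); last first.
    by rewrite /xt scalerBl scale1r opprD addrA (addrAC y) (addrAC (y - x)).
  rewrite (dotvDr g (_ *: _)) dotvZr => gM; apply: le_trans (ler_norm _).
  have : (1 - t) * dotv u (y - x) <= (1 - t) * dotv g (y - x).
    by rewrite ler_wpM2l// subr_ge0.
  by lra.
apply: enorm_le => [|i]; first by rewrite divr_ge0// ltW.
have [/gp + /gp] := rM i; rewrite dotvNr dotvZr dotv_delta => g1 g2.
rewrite ler_pdivlMr// -{1}(gtr0_norm r0) -normrM ler_norml; lra.
Qed.

(** Otherwise [x] is a boundary point approached along a segment from the interior, where the
    gradients stay bounded, against their blow-up. *)
Lemma subdiff_intdom f x u : Defs.proper f -> econvex f ->
  essentially_smooth f -> subdiff f x u -> intdom f x.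
Proof.
move=> fp fcvx fes xu; have [[y yU] _ fblow] := fes; apply: contrapT => xU.
have [b bP] := grad_bounded_near_subdiff _ _ _ _ fp fcvx fes xu yU.
have [a fx] := subdiff_fin _ _ _ fp xu.
pose t n : R := n.+1%:R^-1.
have t0 n : 0 < t n by rewrite invr_gt0.
have t1 n : t n <= 1 by rewrite invf_le1// ler1n.
pose x_ n := x + t n *: (y - x).
have x_U n : intdom f (x_ n) by apply: intdom_segment => //; rewrite fx ltry.
have x_x : x_ @ \oo --> x.
  rewrite -[X in _ --> X]addr0 -(scale0r (y - x)).
  apply: cvgD; first exact: cvg_cst.
  by apply: cvgZr_tmp; exact: cvg_harmonic.
have x_cl : closure (intdom f) x.
  apply: (closed_cvg (closure (intdom f)) (@closed_closure _ _) _ _ x_x).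
  by apply: nearW => n; exact: subset_closure.
have /cvgryPge/(_ (b + 1)) [n _ /(_ n (leqnn n)) /=] :=
  fblow _ _ x_U (conj x_cl xU) x_x.
by have := bP _ (t0 n) (t1 n); rewrite -/(x_ n); lra.
Qed.

Lemma fenchel_ge f x u : ((dotv x u)%:E - f x <= fenchel f u)%E.
Proof. by apply: ereal_sup_ubound; exists x. Qed.

(** The Fenchel-Young equality: a subgradient at [x] makes the term at [x] the largest in the
    supremum. *)
Lemma fenchel_subdiff f x u : Defs.proper f -> subdiff f x u ->
  fenchel f u = ((dotv x u)%:E - f x)%E.
Proof.
move=> fp xu; apply/eqP; rewrite eq_le fenchel_ge andbT.
apply: ge_ereal_sup => _ [z _ <-]; have [a fx] := subdiff_fin _ _ _ fp xu.
have := xu z; rewrite fx dotvBr !(dotvC u); case: (f z) => [b| |] //=.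
  by rewrite -?EFinD -?EFinB !lee_fin; lra.
by rewrite leNye.
Qed.

Lemma compact_cball (b : R) : compact [set z : 'rV[R]_J | `|z| <= b].
Proof.
apply: bounded_closed_compact.
  exists b; split => [|M bM z /= zb]; first exact: num_real.
  exact: le_trans (ltW bM).
apply: (@preimage_closed _ _ (fun z => `|z|) [set r | r <= b]); last exact: closed_le.
by move=> z _; exact: norm_continuous.
Qed.

(* [f* <= M] on the vertices [u +- r e_i] of a cross-polytope makes
   [f - <u, .>] coercive. *)
Lemma intdom_fenchel_subdiff f u : Defs.proper f -> lower_semicontinuous f ->
  intdom (fenchel f) u -> exists x, subdiff f x u.
Proof.
move=> fp flsc /intdom_coord_bound[r [M [r0 rM]]].
have coercive z b i : f z = b%:E -> r * `|z 0 i| <= b - dotv u z + M.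
  move=> fz; have [] := rM i.
  move=> /(le_trans (fenchel_ge _ z _)) + /(le_trans (fenchel_ge _ z _)).
  rewrite fz -!EFinB !lee_fin dotvBr dotvDr dotvZr dotv_delta (dotvC z u) => h1 h2.
  by rewrite -(gtr0_norm r0) -normrM ler_norml; lra.
have [[x0 x0d] fNy] := fp; have fx0 := finepartK _ _ fp x0d.
pose m := finepart f x0 - dotv u x0.
(* Where [tilt f u] is below its value [m] at [x0], coercivity bounds every coordinate by the second
   summand; the first keeps [x0] in the ball. *)
pose b := `|x0| + `|m + M| / r.
have b0 : 0 <= b by rewrite addr_ge0// divr_ge0// ltW.
have Kx0 : `|x0| <= b by rewrite lerDl divr_ge0// ltW.
have [x Kx xmin] := lsc_attains_min _ _ (compact_cball b) (ex_intro _ x0 Kx0)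
  (lsc_tilt _ u flsc).
exists x; apply/subdiffP => // z; case: (leP `|z| b) => [|zb]; first exact: xmin.
apply: le_trans (xmin _ Kx0) _; rewrite leNgt; apply/negP => zx0.
have [c fz] : exists c, f z = c%:E.
  by move: zx0; rewrite /tilt fx0; case: (f z) (fNy z) => [c| |//] _; [exists c|].
move: zx0; rewrite /tilt fz fx0 -!EFinB lte_fin -/m => cm.
move: zb; apply/negP; rewrite -leNgt; apply: ler_norm_coord => // i.
apply: (@le_trans _ _ (`|m + M| / r)); last by rewrite lerDr.
rewrite ler_pdivlMr// mulrC; apply: le_trans (coercive _ _ i fz) _.
by apply: le_trans (ler_norm _); lra.
Qed.

(** The lower bound is the term at [x] of the supremum. For the upper one, the perturbation costs at
    most [J * |z - x| * |w|]: for [z] near [x] this is at most [e * |w|], and for [z] far away the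
    linear growth absorbs it once [w] is small. *)
Lemma fenchel_expansion f x u (a : R) : Defs.proper f ->
  lower_semicontinuous f -> econvex f -> f x = a%:E ->
  (forall z, z <> x -> (tilt f u x < tilt f u z)%E) ->
  forall e : R, 0 < e -> exists2 d : R, 0 < d & forall w, `|w| <= d ->
    ((dotv x (u + w)%R - a)%:E <= fenchel f (u + w)%R)%E /\
    (fenchel f (u + w)%R <= (dotv x (u + w)%R - a + e * `|w|)%:E)%E.
Proof.
move=> fp flsc fcvx fx xmin e e0.
(* [J + 1] instead of [J] keeps the divisors positive in dimension 0. *)
have N0 : 0 < J%:R + 1 :> R by rewrite ltr_wpDl.
have [c c0 cP] := strict_min_growth _ _ (proper_tilt _ u fp) (lsc_tilt _ u flsc)
  (econvex_tilt _ u fp fcvx) xmin _ (divr_gt0 e0 N0).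
exists (c / (J%:R + 1)) => [|w wd]; first exact: divr_gt0.
split; first by have := fenchel_ge f x (u + w); rewrite fx.
apply: ge_ereal_sup => _ [z _ <-].
have xz : (tilt f u x <= tilt f u z)%E.
  by have [->//|/eqP /xmin /ltW] := eqVneq z x.
have := cP z; move: xz; rewrite /tilt fx.
case: (f z) (fp.2 z) => [b| |//] _ //=; last by rewrite leNye.
rewrite -!EFinB -EFinD !lee_fin => xz growth.
have zxw : dotv z w - dotv x w <= J%:R * (`|z - x| * `|w|).
  by rewrite -dotvBl (le_trans (ler_norm _))// ler_norm_dotv.
suff : J%:R * (`|z - x| * `|w|) <= b - dotv u z - (a - dotv u x) + e * `|w|.
  by rewrite !dotvDr (dotvC z u) (dotvC x u); lra.
have J1 : J%:R <= J%:R + 1 :> R by rewrite lerDl.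
have [ezx|zxe] := leP (e / (J%:R + 1)) `|z - x|.
  have {}growth := growth ezx.
  have : J%:R * (`|z - x| * `|w|) <= c * `|z - x|.
    rewrite mulrCA mulrC ler_wpM2r//.
    apply: (@le_trans _ _ ((J%:R + 1) * `|w|)); first by rewrite ler_wpM2r.
    by rewrite mulrC -ler_pdivlMr.
  have : 0 <= e * `|w| by rewrite mulr_ge0// ltW.
  by lra.
have : J%:R * (`|z - x| * `|w|) <= e * `|w|.
  rewrite mulrA ler_wpM2r//.
  apply: (@le_trans _ _ ((J%:R + 1) * `|z - x|)); first by rewrite ler_wpM2r.
  by rewrite mulrC -ler_pdivlMr// ltW.
by lra.
Qed.

(** The upper bound of the expansion makes the conjugate finite near [u]; the two bounds together
    identify [dotv x] as its differential. *)
Lemma grad_fenchel f x u : Defs.proper f -> lower_semicontinuous f ->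
  econvex f -> subdiff f x u ->
  (forall z, z <> x -> (tilt f u x < tilt f u z)%E) ->
  intdom (fenchel f) u /\ grad (fenchel f) u = x.
Proof.
move=> fp flsc fcvx xu xmin; have [a fx] := subdiff_fin _ _ _ fp xu.
have expand := fenchel_expansion _ _ _ _ fp flsc fcvx fx xmin.
split.
  have [d d0 dP] := expand 1 ltr01; apply: (intdom_ball _ _ _ d0) => v vd.
  by have [_ /le_lt_trans] := dP v (ltW vd); apply; exact: ltry.
have dE : 'd (finepart (fenchel f)) u = dotv x :> ('rV[R]_J -> R^o).
  apply: diff_unique; first exact: dotv_continuous.
  apply/eqaddoP => e e0; have [d d0 dP] := expand e e0.
  have near_d : \forall w \near nbhs (0 : 'rV[R]_J), `|w| <= d.
    apply/nbhs_ballP; exists d => //= w.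
    by rewrite -ball_normE /ball_/= sub0r normrN => /ltW.
  apply: filterS near_d => w wd; rewrite /= !fctE /=.
  (* At [w = 0] the two bounds coincide and give the exact value of the conjugate at [u]. *)
  have u0d : `|0 : 'rV[R]_J| <= d by rewrite normr0 ltW.
  have [] := dP w wd; have [] := dP 0 u0d.
  rewrite normr0 mulr0 !addr0 dotvDr [w + u]addrC /finepart.
  case: (fenchel f u) => [s| |] //=; rewrite !lee_fin => s1 s2.
  case: (fenchel f (u + w)) => [r| |] //=; rewrite !lee_fin => r1 r2.
  by rewrite ler_norml; apply/andP; split; lra.
by apply/rowP => i; rewrite mxE dE dotv_delta.
Qed.

(** The points with subgradient [u] form a convex subset of [dom_subdiff f], on which [f] is
    strictly convex. With two such points, the value at their midpoint would violate the subgradient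
    inequality. *)
Lemma legendre_strict_min f x u : legendre f -> subdiff f x u ->
  forall z, z <> x -> (tilt f u x < tilt f u z)%E.
Proof.
move=> [fp _ fcvx _ fesc] xu z zx; rewrite lt_neqAle.
rewrite (subdiffP _ _ _ fp).1// andbT; apply/eqP => tzx.
have zu : subdiff f z u.
  by apply/subdiffP => // y; rewrite -tzx; exact: (subdiffP _ _ _ fp).1.
pose A := [set y | subdiff f y u].
have Acvx : convex_set A.
  apply/convex_setW => y1 y2; rewrite !inE => y1u y2u k k0 k1.
  have min_tilt y : subdiff f y u -> tilt f u y = tilt f u x.
    move=> yu; apply/eqP; rewrite eq_le.
    by rewrite (subdiffP _ _ _ fp).1// (subdiffP _ _ _ fp).1.
  apply/mem_set; apply: (subdiffP _ _ _ fp).2 => y.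
  apply: le_trans ((subdiffP _ _ _ fp).1 xu y).
  have := econvex_tilt _ u fp fcvx y1 y2 k%:num k0 k1.
  have [a fx] := subdiff_fin _ _ _ fp xu.
  have txE : tilt f u x = (a - dotv u x)%:E by rewrite /tilt fx.
  rewrite (min_tilt _ y1u) (min_tilt _ y2u) txE -!EFinM -EFinD => /le_trans; apply.
  by rewrite lee_fin; lra.
have Asub : A `<=` dom_subdiff f by move=> y yu; exists u.
have half0 : 0 < 2^-1 :> R by rewrite invr_gt0.
have half1 : 2^-1 < 1 :> R by lra.
have := fesc _ Acvx Asub z x _ zu xu zx half0 half1.
have [a fx] := subdiff_fin _ _ _ fp xu; have [b fz] := subdiff_fin _ _ _ fp zu.
set mid := 2^-1 *: z + _.
have := xu mid; have := zu mid; rewrite fx fz -!EFinM -!EFinD.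
case: (f mid) => [c| |] //=; rewrite !dotvBr !lee_fin !lte_fin.
rewrite /mid dotvDr !dotvZr; lra.
Qed.

Lemma grad_intdomK f x : legendre f -> intdom f x ->
  intdom (fenchel f) (grad f x) /\ grad (fenchel f) (grad f x) = x.
Proof.
move=> fL xU; have [fp flsc fcvx [_ fdiff _] _] := fL.
have xu : subdiff f x (grad f x) by apply: grad_subdiff => //; exact: fdiff.
by apply: grad_fenchel => //; exact: legendre_strict_min.
Qed.

Lemma grad_fenchelK f u : legendre f -> intdom (fenchel f) u ->
  intdom f (grad (fenchel f) u) /\ grad f (grad (fenchel f) u) = u.
Proof.
move=> fL uV; have [fp flsc fcvx fes _] := fL.
have [x xu] := intdom_fenchel_subdiff _ _ fp flsc uV.
have xU := subdiff_intdom _ _ _ fp fcvx fes xu.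
have [_ fdiff _] := fes.
have -> : u = grad f x by apply: subdiff_grad => //; exact: fdiff.
by have [_ ->] := grad_intdomK _ _ fL xU.
Qed.

(** By the Fenchel-Young equality at [x] and [y], both sides reduce to
    [f y - f x - dotv (grad f x) (y - x)]; duality swaps the arguments. *)
Lemma bregman_fenchel f x y : legendre f -> intdom f x -> intdom f y ->
  bregman (fenchel f) (grad f x) (grad f y) = bregman f y x.
Proof.
move=> fL xU yU; have [fp _ fcvx [_ fdiff _] _] := fL.
have [yV gradK] := grad_intdomK _ _ fL yU.
have sub z : intdom f z -> subdiff f z (grad f z).
  by move=> zU; apply: grad_subdiff => //; exact: fdiff.
rewrite /bregman !asboolT// gradK.
move: (grad f x) (grad f y) (sub x xU) (sub y yU) => u v xu yv.
have [a fx] := subdiff_fin _ _ _ fp xu; have [b fy] := subdiff_fin _ _ _ fp yv.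
rewrite (fenchel_subdiff _ _ _ fp xu) (fenchel_subdiff _ _ _ fp yv) fx fy.
by rewrite -!EFinB !dotvBr (dotvC x) !(dotvC y); congr (_%:E); ring.
Qed.

End Legendre.
Theorem proposition7p1 (R : realType) (J : nat) (f : 'rV[R]_J -> \bar R)
    (C : set 'rV[R]_J)
    (fL : legendre f)
    (C_neq0 : C !=set0)
    (C_bounded : bounded_set C)
    (C_closed : closed C)
    (C_sub : C `<=` intdom f) :
  (forall y, intdom f y ->
     rfarthest f C y =
     grad (fenchel f) @` lfarthest (fenchel f) (grad f @` C) (grad f y)) /\
  (forall y, intdom (fenchel f) y ->
     lfarthest (fenchel f) (grad f @` C) y =
     grad f @` rfarthest f C (grad (fenchel f) y)).
Proof.
(* Both identities come from this one: [grad f] maps [C] onto its image and preserves the distances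
   being maximized. *)
have left_image y : intdom f y ->
    lfarthest (fenchel f) (grad f @` C) (grad f y) = grad f @` rfarthest f C y.
  move=> yU; apply/seteqP; split => [_ [[x Cx <-] xmax]|_ [x [Cx xmax] <-]].
    exists x => //; split => // z Cz.
    rewrite -(bregman_fenchel _ _ _ fL (C_sub _ Cz) yU).
    rewrite -(bregman_fenchel _ _ _ fL (C_sub _ Cx) yU).
    by apply: xmax; exists z.
  split; first by exists x.
  move=> _ [z Cz <-]; have := xmax z Cz.
  rewrite -(bregman_fenchel _ _ _ fL (C_sub _ Cz) yU).
  by rewrite -(bregman_fenchel _ _ _ fL (C_sub _ Cx) yU).
split => [y yU|u uV].
  (* Maximizers lie in [C], inside [intdom f], where the conjugate gradient undoes [grad f]. *)
  have gradK x : rfarthest f C y x -> grad (fenchel f) (grad f x) = x.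
    by case=> Cx _; have [] := grad_intdomK _ _ fL (C_sub _ Cx).
  rewrite left_image//; apply/seteqP; split => [x xy|_ [_ [x xy <-] <-]].
    by exists (grad f x); [exists x|exact: gradK].
  by rewrite gradK.
(* Every [u] is [grad f] of an interior point, so [left_image] applies there. *)
have [xU gradK] := grad_fenchelK _ _ fL uV.
by rewrite -left_image// gradK.
Qed.
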